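(* Let $T$ be a concatenation tree (left or right) whose root has label $\alpha$ and change index $c$, and consider the procedure $\mathrm{RCL}(\alpha,c,\ell)$ (with $\ell=1$ for a left concatenation tree and $\ell=0$ for a right one). The sequence output by the call $\mathrm{RCL}(\alpha,c,\ell)$ is generated in $O(1)$-amortized time per symbol provided that (i) at each recursive step, the total work of all calls to $\mathrm{Child}(\alpha',i)$ made for the current node $\alpha'$ is $O((t+1)n)$, where $t$ is the number of children of $\alpha'$, and (ii) the number of periodic nodes of $T$ is less than some constant times the number of aperiodic nodes of $T$.
   Context: Setting: $\Sigma=\{0,\dots,k-1\}$, strings of length $n$. The aperiodic prefix of $\alpha$ is the shortest $\beta$ with $\alpha=\beta^q$; its length is the period; $\alpha$ is periodic if its period is less than $n$, aperiodic otherwise. A concatenation tree is a rooted tree whose nodes carry labels $\alpha\in\Sigma^n$ and change indices in $\{1,\dots,n\}$, where each non-root node's label differs from its parent's label exactly at the node's change index; the children of a node with change index $c'$ are left-children (change index $<c'$) or right-children (change index $>c'$), each ordered by increasing change index, and children with change index $c'$ are all left-children (left concatenation tree) or all right-children (right concatenation tree); no two children of a node share a change index. Function $\mathrm{Child}(\alpha,i)$ returns the symbol $\mathtt{x}$ if $\mathtt{a}_1\cdots\mathtt{a}_{i-1}\mathtt{x}\mathtt{a}_{i+1}\cdots\mathtt{a}_n$ is (the label of) a child of the node labeled $\alpha=\mathtt{a}_1\cdots\mathtt{a}_n$, and $-1$ otherwise. Procedure $\mathrm{RCL}(\alpha=\mathtt{a}_1\cdots\mathtt{a}_n,c,\ell)$: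 for $i=c+\ell,\dots,n$, set $\mathtt{x}=\mathrm{Child}(\alpha,i)$ and if $\mathtt{x}\ne-1$ call $\mathrm{RCL}(\mathtt{a}_1\cdots\mathtt{a}_{i-1}\mathtt{x}\mathtt{a}_{i+1}\cdots\mathtt{a}_n,i,\ell)$; then output $\mathtt{a}_1\cdots\mathtt{a}_p$ where $p$ is the period of $\alpha$; then for $i=1,\dots,c-1+\ell$, set $\mathtt{x}=\mathrm{Child}(\alpha,i)$ and if $\mathtt{x}\ne-1$ call $\mathrm{RCL}(\mathtt{a}_1\cdots\mathtt{a}_{i-1}\mathtt{x}\mathtt{a}_{i+1}\cdots\mathtt{a}_n,i,\ell)$. *)

(* Defs.v *)
From HB Require Import structures.
From mathcomp Require Import all_boot zify.
From Stdlib Require List.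

Set Implicit Arguments.
Unset Strict Implicit.
Unset Printing Implicit Defensive.

(* Positions are numbered from 0, so the position i of the mathematical text
   is i - 1 here; the alphabet is 'I_k and a string of length n is an
   n.-tuple 'I_k.                                                           *)

Section Periods.

Variable T : eqType.
Implicit Type a b : seq T.

Definition power b (q : nat) : seq T := flatten (nseq q b).

(* The bound on the exponent is harmless: a nonempty string that is the q-th
   power of some string has length at least q.                              *)
Definition is_power_of_prefix a (p : nat) : bool :=
  [exists q : 'I_(size a).+1, a == power (take p a) q].

Lemma is_power_of_prefix_size a : exists p, is_power_of_prefix a p.
Proof.
exists (size a); apply/existsP; rewrite take_size /power.
case: a => [|x a]; first by exists ord0.
by exists (inord 1); rewrite inordK //= cats0.
Qed.

Definition period a : nat := ex_minn (is_power_of_prefix_size a).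

Definition aperiodic_prefix a : seq T := take (period a) a.

Definition periodic a : bool := period a < size a.

Definition aperiodic a : bool := ~~ periodic a.

End Periods.

(* Running times. A computation returns its value together with the number of
   elementary steps it takes. One step is charged for every iteration of every
   loop; an iteration performs boundedly many unit-cost operations of a
   random access machine: arithmetic on integers of size at most n, reading
   or writing one array cell, comparing two symbols. An array is a list here:
   [onth] and [nth] read a cell, [rcons] writes the next one.               *)

Definition timed (A : Type) : Type := (A * nat)%type.

Definition ret (A : Type) (x : A) : timed A := (x, 0).

Definition tick (A : Type) (m : timed A) : timed A := (m.1, m.2.+1).

Definition bind (A B : Type) (m : timed A) (f : A -> timed B) : timed B :=
  ((f m.1).1, m.2 + (f m.1).2).

Notation "'do' x <- m ; e" := (bind m (fun x => e))
  (at level 200, x name, m at level 100, e at level 200).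

Section FindPeriod.

Variable T : eqType.
Implicit Types (a : seq T) (bd : seq nat).

(* The Knuth-Morris-Pratt failure function: the entry of index m (0 < m) of
   the array bd is the length of the longest proper border of take m a. The
   argument [fuel] only makes the recursion structural; the length of the
   current border strictly decreases along the loop.                        *)
Fixpoint extend_border a bd (m b fuel : nat) : timed nat :=
  tick (if onth a b == onth a m then ret b.+1
        else if b == 0 then ret 0
        else if fuel is fuel'.+1 then extend_border a bd m (nth 0 bd b) fuel'
        else ret 0).

Fixpoint fill_borders a bd (m r : nat) : timed (seq nat) :=
  if r is r'.+1 then
    tick (do b <- extend_border a bd m (nth 0 bd m) m;
          fill_borders a (rcons bd b) m.+1 r')
  else ret bd.

Definition border_array a : timed (seq nat) :=
  tick (fill_borders a [:: 0; 0] 1 (size a).-1).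

(* Runs through the borders of a string of length n from the longest to the
   shortest, until the shift n - b of the current one divides n.            *)
Fixpoint scan_borders bd (n b fuel : nat) : timed nat :=
  tick (if n - b %| n then ret (n - b)
        else if fuel is fuel'.+1 then scan_borders bd n (nth 0 bd b) fuel'
        else ret n).

Definition find_period a : timed nat :=
  do bd <- border_array a;
  scan_borders bd (size a) (nth 0 bd (size a)) (size a).

(* take m a has a border of length b < m. *)
Definition bordered a (m b : nat) : Prop :=
  b < m /\ forall j, j < b -> onth a j = onth a (m - b + j).

Definition max_border a m b : Prop :=
  bordered a m b /\ forall b', bordered a m b' -> b' <= b.

Definition filled_upto a bd m : Prop :=
  size bd = m.+1 /\
  forall m', 0 < m' <= m -> max_border a m' (nth 0 bd m').

Lemma bordered_sub a m b b' :
  bordered a m b -> bordered a m b' -> b' < b -> bordered a b b'.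
Proof.
move=> [h1 h2] [h3 h4] h; split=> // j hj; rewrite (h4 j hj) (h2 (b - b' + j));
  last by lia.
by congr onth; lia.
Qed.

Lemma bordered_trans a m b b' :
  bordered a m b -> bordered a b b' -> bordered a m b'.
Proof.
move=> [h1 h2] [h3 h4]; split; first by lia.
move=> j hj; rewrite h4 // h2; last by lia.
by congr onth; lia.
Qed.

Lemma borderedS a m b : bordered a m.+1 b.+1 <-> bordered a m b /\ onth a b = onth a m.
Proof.
split=> [[h1 h2]|[[h1 h2] h3]].
  split; last by rewrite h2 //; congr onth; lia.
  split=> // j hj; rewrite h2; last by lia.
  by congr onth; lia.
split=> // j; rewrite ltnS leq_eqVlt => /orP[/eqP->|hj].
  by rewrite h3; congr onth; lia.
by rewrite h2.
Qed.

Lemma extend_borderP a bd m b fuel : filled_upto a bd m -> b <= fuel -> bordered a m b ->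
  (forall b', bordered a m.+1 b'.+1 -> b' <= b) ->
  max_border a m.+1 (extend_border a bd m b fuel).1.
Proof.
move=> [_ G]; elim: fuel b => [|f IH] b le bm mx /=; case: eqP => e /=.
- by split; [apply/borderedS | case=> // b' /mx].
- have -> /= : b == 0 by lia.
  split=> // -[//|b' hb]; have := mx _ hb; case/borderedS: hb => _ e2 h.
  by have e3 : b' = b by [lia]; case: e; rewrite -e3.
- by split; [apply/borderedS | case=> // b' /mx].
case: (eqVneq b 0) => [b0|b0] /=.
  split=> // -[//|b' hb]; have := mx _ hb; case/borderedS: hb => _ e2 h.
  by have e3 : b' = b by [lia]; case: e; rewrite -e3.
case: (G b) => [|g1 g2]; first by case: bm; lia.
apply: IH.
- by case: g1; lia.
- exact: bordered_trans g1.
move=> b' hb; have h := mx _ hb; case/borderedS: hb => h1 h2.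
apply: g2; apply: bordered_sub bm h1 _; rewrite ltn_neqAle h andbT.
by apply/eqP=> e2; apply: e; rewrite -e2.
Qed.

Lemma fill_bordersP a bd m r : 0 < m -> filled_upto a bd m ->
  filled_upto a (fill_borders a bd m r).1 (m + r).
Proof.
elim: r bd m => [|r IH] bd m m0 G /=; first by rewrite addn0.
rewrite addnS -addSn; apply: IH => //.
have [g1 g2] : max_border a m (nth 0 bd m) by apply: G.2; lia.
have E : max_border a m.+1 (extend_border a bd m (nth 0 bd m) m).1.
  apply: extend_borderP => //; first by case: g1; lia.
  by move=> b' /borderedS[/g2].
case: G => sz G; split; first by rewrite size_rcons sz.
move=> m' hm; rewrite nth_rcons sz; case: ltnP => h; first by apply: G; lia.
by have -> : m' = m.+1 by [lia]; rewrite eqxx.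
Qed.

Lemma scan_bordersP a bd n b fuel : filled_upto a bd n -> b <= fuel -> bordered a n b ->
  (forall b', bordered a n b' -> n - b' %| n -> b' <= b) ->
  exists2 b0, (scan_borders bd n b fuel).1 = n - b0 &
   [/\ bordered a n b0, n - b0 %| n
     & forall b', bordered a n b' -> n - b' %| n -> b' <= b0].
Proof.
move=> [_ G]; elim: fuel b => [|f IH] b le bm mx /=; case: ifP => e /=.
- by exists b.
- by move: e; have -> : b = 0 by [lia]; rewrite subn0 dvdnn.
- by exists b.
have b0 : 0 < b by case: b e {le bm mx} => //; rewrite subn0 dvdnn.
case: (G b) => [|g1 g2]; first by case: bm; lia.
apply: IH.
- by case: g1; lia.
- exact: bordered_trans g1.
move=> b' hb d; have h := mx _ hb d.
apply: g2; apply: bordered_sub bm hb _; rewrite ltn_neqAle h andbT.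
by apply/eqP=> e2; rewrite -e2 d in e.
Qed.

Lemma size_power (b : seq T) q : size (power b q) = q * size b.
Proof. by rewrite /power size_flatten /shape map_nseq sumn_nseq mulnC. Qed.

Lemma power_bordered a p q : 0 < size a -> p <= size a -> a = power (take p a) q ->
  [/\ 0 < p, p %| size a & bordered a (size a) (size a - p)].
Proof.
move=> a0 pa e; have sz : size a = q * p.
  by rewrite {1}e size_power size_takel.
have p0 : 0 < p by case: p {pa e} sz => //; lia.
split=> //; first by rewrite sz dvdn_mull.
split; first by lia.
move=> j hj; rewrite subKn //.
have st : size (take p a) = p by rewrite size_takel.
case: q e sz => [|q] e sz; first by lia.
have e1 : a = take p a ++ power (take p a) q by [].
have e2 : a = power (take p a) q ++ take p a.
  by rewrite {1}e /power -(addn1 q) nseqD flatten_cat /= cats0.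
rewrite {2}e1 onth_cat st ltnNge leq_addr /= addKn {1}e2 onth_cat size_power st.
by have -> : j < q * p by lia.
Qed.

Lemma bordered_power a p q : size a = q * p -> 0 < p ->
  (forall j, j < size a - p -> onth a j = onth a (p + j)) -> a = power (take p a) q.
Proof.
elim: q a => [|q IH] a sz p0 H; first by apply/size0nil.
rewrite -{1}(cat_take_drop p a) /power /=; congr (_ ++ _).
case: q => [|q] in IH sz *; first by rewrite drop_oversize //; lia.
have od i : onth (drop p a) i = onth a (p + i).
  by rewrite !onthE map_drop nth_drop.
rewrite {1}[drop p a]IH //; first 1 last.
- by rewrite size_drop sz; lia.
- by move=> j; rewrite size_drop !od => hj; apply: H; lia.
suff -> : take p (drop p a) = take p a by []; apply: eq_from_onth => i.
case: (ltnP i p) => h; last by rewrite !onth_default // size_take_min ?size_drop; lia.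
have ot (s : seq T) : onth (take p s) i = onth s i.
  by rewrite -{2}(cat_take_drop p s) onth_cat size_take_min; case: ltnP => //;
  move=> h2; rewrite !onth_default // ?size_drop ?size_take_min; lia.
by rewrite !ot od -H //; lia.
Qed.

Lemma find_periodE a : (find_period a).1 = period a.
Proof.
case: (posnP (size a)) => [a0|a0].
  rewrite (size0nil a0) /period; case: ex_minnP => p _ /(_ 0) H /=.
  apply/esym/eqP; rewrite -leqn0; apply: H; by apply/existsP; exists ord0.
rewrite /find_period /bind /=; set bd := (fill_borders _ _ _ _).1.
have G : filled_upto a bd (size a).
  rewrite -[X in filled_upto _ _ X](prednK a0) -add1n.
  apply: fill_bordersP => //; split=> // m' h.
  by have -> : m' = 1 by [lia]; split=> // b' [].
have [g1 g2] : max_border a (size a) (nth 0 bd (size a)) by apply: G.2; lia.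
have [] := scan_bordersP (fuel := size a) G _ g1; first by case: g1; lia.
  by move=> b' h _; apply: g2.
move=> b -> [h1 h2 h3]; rewrite /period; case: ex_minnP => p /existsP[q /eqP e] mn.
have bs : b < size a by case: h1.
have le : p <= size a - b.
  apply: mn; apply/existsP; have [q' sq] := dvdnP h2.
  have hq : q' < (size a).+1 by rewrite ltnS sq leq_pmulr; lia.
  exists (Ordinal hq); apply/eqP; apply: bordered_power => //; first by lia.
  move=> j hj; case: h1 => _ -> //; lia.
have [p0 dp hp] := power_bordered a0 (leq_trans le (leq_subr _ _)) e.
have := h3 _ hp; rewrite subKn; last by lia.
by move=> /(_ dp); lia.
Qed.

End FindPeriod.

Section ConcatenationTrees.

Variables n k : nat.

Notation string := (n.-tuple 'I_k).

(* A rooted tree with, at each node, a label, a change index, an ordered list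
   of left-children and an ordered list of right-children.                  *)
Inductive tree : Type :=
  Node of string & 'I_n & seq tree & seq tree.

Definition label (v : tree) : string := let: Node a _ _ _ := v in a.
Definition change_index (v : tree) : 'I_n := let: Node _ c _ _ := v in c.
Definition left_children (v : tree) : seq tree := let: Node _ _ l _ := v in l.
Definition right_children (v : tree) : seq tree := let: Node _ _ _ r := v in r.
Definition children (v : tree) : seq tree :=
  left_children v ++ right_children v.

Fixpoint nodes (v : tree) : seq tree :=
  let: Node _ _ l r := v in
  v :: flatten (map nodes l) ++ flatten (map nodes r).

Variant side : Type := Left | Right.

Definition is_left_index (s : side) (c d : 'I_n) : bool :=
  if s is Left then d <= c else d < c.

Definition is_right_index (s : side) (c d : 'I_n) : bool :=
  if s is Left then c < d else c <= d.

Definition differ_exactly_at (a b : string) (c : 'I_n) : Prop :=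
  forall j : 'I_n, (tnth a j != tnth b j) = (j == c).

Definition lt_change_index (u v : tree) : bool :=
  change_index u < change_index v.

Record concatenation_node (s : side) (v : tree) : Prop := ConcatenationNode {
  child_label : forall u, List.In u (children v) ->
    differ_exactly_at (label u) (label v) (change_index u);
  children_uniq : uniq (map change_index (children v));
  left_child_index : forall u, List.In u (left_children v) ->
    is_left_index s (change_index v) (change_index u);
  right_child_index : forall u, List.In u (right_children v) ->
    is_right_index s (change_index v) (change_index u);
  left_children_sorted : sorted lt_change_index (left_children v);
  right_children_sorted : sorted lt_change_index (right_children v)
}.

Definition concatenation_tree (s : side) (t : tree) : Prop :=
  forall v, List.In v (nodes t) -> concatenation_node s v.

Definition set_symbol (a : string) (i : 'I_n) (x : 'I_k) : string :=
  [tuple if j == i then x else tnth a j | j < n].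

(* The returned value -1 is encoded by None. *)
Definition implements_Child (t : tree) (Child : string -> 'I_n -> option 'I_k)
    : Prop :=
  forall v, List.In v (nodes t) -> forall (i : 'I_n) (x : 'I_k),
    Child (label v) i = Some x <->
    exists2 u, List.In u (children v) & label u = set_symbol (label v) i x.

Definition num_periodic (t : tree) : nat :=
  count (fun v => periodic (label v)) (nodes t).

Definition num_aperiodic (t : tree) : nat :=
  count (fun v => aperiodic (label v)) (nodes t).

Definition ell (s : side) : nat := if s is Left then 1 else 0.

Section RCL.

Variables (Child : string -> 'I_n -> option 'I_k)
          (work : string -> 'I_n -> nat) (l : nat).

(* Big-step semantics with running times: [RCL a c out time] means that the
   call RCL(a, c, l) terminates, outputs [out] and takes [time] steps, where
   the call Child(a, i) takes [work a i] steps. A call of RCL is charged 1 step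
   plus n steps for passing the string a, the steps of [find_period a], whose
   value is [period a] by [find_periodE], and 1 step per symbol of the output
   prefix. [RCL_loop a s out time] is the
   same for the loop over the list of positions s, each iteration being
   charged 1 step besides the calls it makes.                               *)
Inductive RCL : string -> 'I_n -> seq 'I_k -> nat -> Prop :=
| RCL_call a (c : 'I_n) out1 time1 out2 time2 :
    RCL_loop a [seq i : 'I_n <- enum 'I_n | c + l <= i] out1 time1 ->
    RCL_loop a [seq i : 'I_n <- enum 'I_n | i < c + l] out2 time2 ->
    RCL a c (out1 ++ aperiodic_prefix a ++ out2)
      (1 + n + time1 + (find_period a).2 + period a + time2)
with RCL_loop : string -> seq 'I_n -> seq 'I_k -> nat -> Prop :=
| RCL_done a : RCL_loop a [::] [::] 0
| RCL_skip a i s out time :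
    Child a i = None ->
    RCL_loop a s out time ->
    RCL_loop a (i :: s) out (1 + work a i + time)
| RCL_rec a i s x out1 time1 out2 time2 :
    Child a i = Some x ->
    RCL (set_symbol a i x) i out1 time1 ->
    RCL_loop a s out2 time2 ->
    RCL_loop a (i :: s) (out1 ++ out2) (1 + work a i + time1 + time2).

End RCL.

End ConcatenationTrees.

(* Main.v *)
Require Import Defs.
From mathcomp Require Import all_boot zify.
From Stdlib Require List.

Set Implicit Arguments.
Unset Strict Implicit.
Unset Printing Implicit Defensive.

(** RCL visits every node of the tree exactly once. Apart from the recursive
    calls, a node with t children costs O(n) for the loops, the output and the
    Knuth-Morris-Pratt computation of the period, and O((t + 1) n) for the calls
    of Child. The numbers of children sum to less than the number N of nodes, so
    the total time is O(n N). An aperiodic node outputs n symbols, and a constant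
    fraction of the N nodes are aperiodic. *)

(** * Sums over lists and over fibres of a map *)

Section ListSums.

Variables (A : Type) (I : eqType).
Implicit Types (r : seq A) (F G : A -> nat) (f : A -> I).

(** Trees carry no [eqType] structure, so membership in lists of trees is [List.In]. *)
Lemma In_catl r1 r2 x : List.In x r1 -> List.In x (r1 ++ r2).
Proof. by elim: r1 => //= y r1 IH [->|/IH]; [left | right]. Qed.

Lemma In_catr r1 r2 x : List.In x r2 -> List.In x (r1 ++ r2).
Proof. by elim: r1 => //= y r1 IH /IH; right. Qed.

Lemma In_flatten_map (g : A -> seq A) r x y :
  List.In x r -> List.In y (g x) -> List.In y (flatten (map g r)).
Proof.
elim: r => //= z r IH [->|xr] yx; first exact: In_catl.
by apply: In_catr; apply: IH.
Qed.

Lemma leq_sum_In r F G : (forall x, List.In x r -> F x <= G x) ->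
  \sum_(x <- r) F x <= \sum_(x <- r) G x.
Proof.
elim: r => [|y r IH] H; first by rewrite !big_nil.
rewrite !big_cons; apply: leq_add; first by apply: H; left.
by apply: IH => x xr; apply: H; right.
Qed.

Lemma leq_sum1_In r F x : List.In x r -> F x <= \sum_(y <- r) F y.
Proof.
elim: r => //= y r IH; rewrite big_cons => -[->|/IH]; first exact: leq_addr.
by move=> h; apply: leq_trans h (leq_addl _ _).
Qed.

Lemma sum_fiber_notIn r F f i : (forall x, List.In x r -> f x <> i) ->
  \sum_(x <- r | f x == i) F x = 0.
Proof.
elim: r => [|y r IH] H; first by rewrite big_nil.
rewrite big_cons; case: eqP => [e|_]; first by case: (H y); [left|].
by apply: IH => x xr; apply: H; right.
Qed.

(** Siblings have distinct change indices, so a fibre of [change_index] holds at most one child. *)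
Lemma sum_fiber_uniq r F f x : uniq (map f r) -> List.In x r ->
  \sum_(y <- r | f y == f x) F y = F x.
Proof.
have In_map (s : seq A) z : List.In z s -> f z \in map f s.
  by elim: s => //= y s IH [->|/IH]; rewrite inE ?eqxx // orbC => ->.
elim: r => //= y r IH /andP[nyr ur]; rewrite big_cons => -[e|xr].
  rewrite e eqxx sum_fiber_notIn ?addn0 // => z zr fz.
  by move: nyr; rewrite e -fz In_map.
case: eqP => [e|_]; last exact: IH.
by move: nyr; rewrite e In_map.
Qed.

End ListSums.

(** * Linear time for computing the period *)

Section FindPeriodTime.

Variable T : eqType.
Implicit Types (a : seq T) (bd : seq nat).

Definition decreasing_links bd := forall b, 0 < b -> nth 0 bd b < b.

Lemma extend_border_gt0 a bd m b fuel : 0 < (extend_border a bd m b fuel).2.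
Proof. by case: fuel. Qed.

(* The value serves as the potential: every step but the last decreases the
   current border. *)
Lemma extend_border_time a bd m b fuel : decreasing_links bd ->
  (extend_border a bd m b fuel).2 + (extend_border a bd m b fuel).1 <= b + 2.
Proof.
move=> D; elim: fuel b => [|fuel IH] b /=; case: eqP => _ //=; try lia;
  case: (eqVneq b 0) => [b0|b0] //=; try lia.
have := IH (nth 0 bd b); have := D b; lia.
Qed.

Lemma decreasing_links_rcons bd b :
  decreasing_links bd -> (0 < size bd -> b < size bd) ->
  decreasing_links (rcons bd b).
Proof.
move=> D h j j0; rewrite nth_rcons; case: (ltnP j (size bd)) => _.
  exact: D.
by case: eqP => // e; rewrite e h // -e.
Qed.

(** Amortization with the current border [nth 0 bd m] as potential: each round raises it by at most
    2 minus the steps of [extend_border], and one more step is charged for the round itself. *)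
Lemma fill_borders_time a bd m r :
  0 < m -> size bd = m.+1 -> decreasing_links bd ->
  let: (bd', t) := fill_borders a bd m r in
  decreasing_links bd' /\ t <= 3 * r + nth 0 bd m.
Proof.
elim: r bd m => [|r IH] bd m m0 sz D /=; first by split.
have E := extend_border_time a m (nth 0 bd m) m D.
(* Since at least one step is spent, [E] bounds the new border by the old one plus 1, which keeps
   the links decreasing. *)
have P := extend_border_gt0 a bd m (nth 0 bd m) m.
rewrite /bind; case: extend_border E P => b t /= E P.
have := D m m0 => Dm.
have /(IH _ m.+1) : decreasing_links (rcons bd b).
  by apply: decreasing_links_rcons => //; lia.
rewrite size_rcons sz nth_rcons sz ltnn eqxx => /(_ isT erefl).
case: fill_borders => bd' t' [D' le] /=; split=> //; lia.
Qed.

Lemma scan_borders_time bd n b fuel : decreasing_links bd ->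
  (scan_borders bd n b fuel).2 <= b.+1.
Proof.
move=> D; elim: fuel b => [|fuel IH] b /=; case: ifP => e //=.
(* The scan stops at border 0 at the latest, as the shift [n] divides [n]. *)
have b0 : 0 < b by case: b e => //; rewrite subn0 dvdnn.
by have := IH (nth 0 bd b); have := D _ b0; lia.
Qed.

Lemma find_period_time a : 0 < size a -> (find_period a).2 <= 4 * size a.
Proof.
move=> a0; rewrite /find_period /border_array /bind /tick /=.
have D0 : decreasing_links [:: 0; 0] by case=> [|[|[|j]]].
have := fill_borders_time a (size a).-1 (isT : 0 < 1) (erefl : size [:: 0; 0] = 2) D0.
case: fill_borders => bd t /= [D le].
have := scan_borders_time (size a) (nth 0 bd (size a)) (size a) D.
(* The array costs at most [1 + 3 * (size a).-1], and the scan at most [size a], as it starts from a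
   border shorter than [a]. *)
have := D _ a0; lia.
Qed.

Lemma period_le a : period a <= size a.
Proof.
rewrite /period; case: ex_minnP => p _; apply; apply/existsP.
(* The exponent is 1, or 0 for the empty string. *)
rewrite take_size; exists (inord (size a != 0)); rewrite /power.
by case: a => [|x a]; rewrite inordK //= ?cats0.
Qed.

End FindPeriodTime.

(** * Counting over the nodes of a tree *)

Section Trees.

Variables n k : nat.
Implicit Types (u v w : tree n k) (s : side).

Lemma nodesE v : nodes v = v :: flatten (map (@nodes n k) (children v)).
Proof. by case: v => a c l r; rewrite /children map_cat flatten_cat. Qed.

Lemma sum_nodes (F : tree n k -> nat) v :
  \sum_(w <- nodes v) F w =
  F v + \sum_(u <- children v) \sum_(w <- nodes u) F w.
Proof. by rewrite nodesE big_cons big_flatten big_map. Qed.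

Lemma In_nodes_root v : List.In v (nodes v).
Proof. by rewrite nodesE; left. Qed.

Lemma In_nodes_child v u w :
  List.In u (children v) -> List.In w (nodes u) -> List.In w (nodes v).
Proof. by move=> uv wu; rewrite nodesE; right; apply: In_flatten_map wu. Qed.

(** Induction on the number of nodes, giving a hypothesis for the children inside the nested
    lists. *)
Lemma tree_children_ind (P : tree n k -> Prop) :
  (forall v, (forall u, List.In u (children v) -> P u) -> P v) ->
  forall v, P v.
Proof.
move=> H v; have [m] := ubnP (\sum_(w <- nodes v) 1).
elim: m v => // m IH v; rewrite sum_nodes ltnS => lt_m.
apply: H => u uv; apply: IH; apply: leq_trans lt_m.
rewrite add1n ltnS.
exact: (leq_sum1_In (fun u => \sum_(w <- nodes u) 1)).
Qed.

(** Each node except the root is counted once, as a child of its parent. *)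
Lemma sum_size_children v :
  (\sum_(w <- nodes v) size (children w)).+1 = size (nodes v).
Proof.
elim/tree_children_ind: v => v IH.
rewrite -[RHS]sum1_size !sum_nodes add1n -sum1_size -big_split /=; congr _.+1; apply/eqP.
by rewrite eqn_leq !leq_sum_In // => u uv; rewrite add1n sum1_size IH.
Qed.

Lemma label_child s v u : concatenation_node s v -> List.In u (children v) ->
  label u = set_symbol (label v) (change_index u)
                       (tnth (label u) (change_index u)).
Proof.
move=> cv uv; apply: eq_from_tnth => j; rewrite tnth_mktuple.
have := child_label cv uv j; case: (eqVneq j (change_index u)) => [->|_] //.
by move/negbFE/eqP.
Qed.

(** A child differs from its parent at its change index, whereas [set_symbol] alters position [i]
    only. *)
Lemma change_index_child s v u i x :
  concatenation_node s v -> List.In u (children v) ->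
  label u = set_symbol (label v) i x -> change_index u = i.
Proof.
move=> cv uv e; have := child_label cv uv (change_index u).
by rewrite e tnth_mktuple; case: (eqVneq _ i) => // _; rewrite !eqxx.
Qed.

Lemma sum_fibers_children v (F : tree n k -> nat) :
  \sum_(i : 'I_n) \sum_(u <- children v | change_index u == i) F u =
  \sum_(u <- children v) F u.
Proof.
rewrite (exchange_big_dep xpredT) //=; apply: eq_bigr => u _.
by rewrite (big_pred1 (change_index u)) // => i; rewrite eq_sym.
Qed.

(** The two loops of a call visit each position once, wherever they are split; hence the cost
    depends on neither [c] nor [l]. *)
Lemma sum_split_positions m (F : 'I_n -> nat) :
  \sum_(i <- [seq i : 'I_n <- enum 'I_n | m <= i]) F i +
  \sum_(i <- [seq i : 'I_n <- enum 'I_n | i < m]) F i = \sum_(i < n) F i.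
Proof.
rewrite !big_filter !big_enum_cond /= [RHS](bigID (fun i : 'I_n => m <= i)) /=.
by congr (_ + _); apply: eq_bigl => i; rewrite ltnNge.
Qed.

Lemma size_nodes v : size (nodes v) = num_periodic v + num_aperiodic v.
Proof. by rewrite /num_periodic /num_aperiodic count_predC. Qed.

Lemma aperiodic_period (a : n.-tuple 'I_k) : aperiodic a -> period a = n.
Proof.
by have := period_le a; rewrite /aperiodic /periodic size_tuple; lia.
Qed.

Lemma num_aperiodic_le v :
  n * num_aperiodic v <= \sum_(w <- nodes v) period (label w).
Proof.
rewrite /num_aperiodic; elim: (nodes v) => [|w r IH] /=.
  by rewrite muln0.
rewrite big_cons mulnDr leq_add //.
by case: (boolP (aperiodic _)) => [/aperiodic_period ->|_]; lia.
Qed.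

(** * Exact output length and running time of RCL *)

Section Execution.

Variables (Child : n.-tuple 'I_k -> 'I_n -> option 'I_k)
          (work : n.-tuple 'I_k -> 'I_n -> nat) (l : nat).

(** The steps of one call without its recursive calls; its two loops make [n] iterations in all. *)
Definition node_time (a : n.-tuple 'I_k) : nat :=
  1 + n + (find_period a).2 + period a + \sum_(i < n) (1 + work a i).

Definition tree_size v := \sum_(w <- nodes v) period (label w).
Definition tree_time v := \sum_(w <- nodes v) node_time (label w).

Section Loop.

Variables (s : side) (v : tree n k).
Hypotheses (cv : concatenation_node s v)
  (Cv : forall i x, Child (label v) i = Some x <->
     exists2 u, List.In u (children v) & label u = set_symbol (label v) i x).

Lemma Child_None i : Child (label v) i = None ->
  forall u, List.In u (children v) -> change_index u <> i.
Proof.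
move=> N u uv e; have h := label_child cv uv; rewrite e in h.
suff : Child (label v) i = Some (tnth (label u) i) by rewrite N.
by apply/Cv; exists u.
Qed.

Lemma Child_Some i x : Child (label v) i = Some x ->
  exists2 u, List.In u (children v) &
    change_index u = i /\ label u = set_symbol (label v) i x.
Proof.
by move=> /Cv[u uv e]; exists u => //; split=> //; exact: change_index_child cv uv e.
Qed.

(** The iteration at [i] recurses into the only child with change index [i], or finds an empty
    fibre. *)
Lemma RCL_loop_cost r out time :
  (forall u c out time, List.In u (children v) ->
     RCL Child work l (label u) c out time ->
     size out = tree_size u /\ time = tree_time u) ->
  RCL_loop Child work l (label v) r out time ->
  size out = \sum_(i <- r)
    \sum_(u <- children v | change_index u == i) tree_size u /\
  time = \sum_(i <- r) (1 + work (label v) i +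
    \sum_(u <- children v | change_index u == i) tree_time u).
Proof.
move=> IH; elim: r out time => [|i r IHr] out time H.
  by inversion H; rewrite !big_nil.
rewrite !big_cons; inversion H as [|? ? ? ? ? N L|? ? ? ? ? ? ? ? S R L]; subst.
  have [-> ->] := IHr _ _ L.
  by rewrite !(sum_fiber_notIn _ (Child_None N)) addn0.
have [u uv [e lu]] := Child_Some S; rewrite -lu in R.
have [e1 e2] := IH _ _ _ _ uv R; have [e3 e4] := IHr _ _ L.
rewrite -e !(sum_fiber_uniq _ (children_uniq cv) uv) size_cat e1 e2 e3 e4 e.
by [].
Qed.

Lemma RCL_loop_terminates r :
  (forall u c, List.In u (children v) ->
     exists out time, RCL Child work l (label u) c out time) ->
  exists out time, RCL_loop Child work l (label v) r out time.
Proof.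
move=> IH; elim: r => [|i r [out2 [time2 L]]]; first by do 2!eexists; constructor.
case S : (Child (label v) i) => [x|]; last by do 2!eexists; apply: RCL_skip L.
have [u uv [_ lu]] := Child_Some S.
have [out1 [time1 R]] := IH u i uv; rewrite lu in R.
by do 2!eexists; apply: RCL_rec S R L.
Qed.

End Loop.

Lemma implements_Child_child v u : List.In u (children v) ->
  implements_Child v Child -> implements_Child u Child.
Proof. by move=> uv H w wu; apply: H; apply: In_nodes_child wu. Qed.

Lemma concatenation_tree_child s v u : List.In u (children v) ->
  concatenation_tree s v -> concatenation_tree s u.
Proof. by move=> uv H w wu; apply: H; apply: In_nodes_child wu. Qed.

Lemma RCL_terminates s v c :
  concatenation_tree s v -> implements_Child v Child ->
  exists out time, RCL Child work l (label v) c out time.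
Proof.
elim/tree_children_ind: v c => v IH c cT CT.
have v_v := In_nodes_root v.
have L r : exists out time, RCL_loop Child work l (label v) r out time.
  apply: (RCL_loop_terminates (cT _ v_v) (CT _ v_v)) => u d uv.
  apply: IH => //; first exact: concatenation_tree_child cT.
  exact: implements_Child_child CT.
have [o1 [t1 L1]] := L [seq i : 'I_n <- enum 'I_n | c + l <= i].
have [o2 [t2 L2]] := L [seq i : 'I_n <- enum 'I_n | i < c + l].
by do 2!eexists; apply: RCL_call L1 L2.
Qed.

Lemma RCL_cost s v c out time :
  concatenation_tree s v -> implements_Child v Child ->
  RCL Child work l (label v) c out time ->
  size out = tree_size v /\ time = tree_time v.
Proof.
elim/tree_children_ind: v c out time => v IH c out time cT CT H.
have v_v := In_nodes_root v.
have L := RCL_loop_cost (cT _ v_v) (CT _ v_v).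
inversion H as [? ? o1 t1 o2 t2 L1 L2]; subst.
have {}IH u d o t : List.In u (children v) ->
    RCL Child work l (label u) d o t -> size o = tree_size u /\ t = tree_time u.
  move=> uv; apply: IH => //; first exact: concatenation_tree_child cT.
  exact: implements_Child_child CT.
have [s1 e1] := L _ _ _ IH L1; have [s2 e2] := L _ _ _ IH L2.
have sp : size (aperiodic_prefix (label v)) = period (label v).
  by rewrite size_takel // period_le.
rewrite /tree_size /tree_time !sum_nodes; split.
  by rewrite !size_cat sp s1 s2 addnCA sum_split_positions sum_fibers_children.
(* Merges both loops into one sum over positions, whose recursive part then becomes a sum over
   children. *)
have E := sum_split_positions (c + l) (fun i => 1 + work (label v) i +
    \sum_(u <- children v | change_index u == i) tree_time u).
rewrite -e1 -e2 big_split /= sum_fibers_children /tree_time in E.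
rewrite {1}/node_time -[RHS]addnA -E; clear; lia.
Qed.

(** * Upper bound on the total time *)

Lemma node_time_le (a : n.-tuple 'I_k) : 0 < n ->
  node_time a <= 8 * n + \sum_(i < n) work a i.
Proof.
move=> n0; have E : \sum_(i < n) (1 + work a i) = n + \sum_(i < n) work a i.
  by rewrite big_split /= sum1_card card_ord.
rewrite /node_time E.
(* The total is [1 + n] for the call, [4 * n] for finding the period, [n] for the output and [n] for
   the iterations, at most [8 * n] as [0 < n]. *)
have := period_le a; have := @find_period_time _ a; rewrite size_tuple.
move: (find_period a).2 (period a) => t p /(_ n0); lia.
Qed.

Lemma tree_time_le K1 v : 0 < n ->
  (forall w, List.In w (nodes v) ->
     \sum_(i < n) work (label w) i <= K1 * ((size (children w)).+1 * n)) ->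
  tree_time v <= (8 + 2 * K1) * n * size (nodes v).
Proof.
move=> n0 H; pose F w := (8 + K1) * n * 1 + K1 * n * size (children w).
apply: (@leq_trans (\sum_(w <- nodes v) F w)).
  apply: leq_sum_In => w wv; apply: leq_trans (node_time_le _ n0) _.
  by have := H w wv; rewrite /F; nia.
(* The second summand of [F] adds up to [K1 * n] times the number of non-root nodes, whence the
   second [K1]. *)
rewrite big_split /= -!big_distrr /= sum1_size -{2}sum_size_children.
by rewrite -{1}sum_size_children; nia.
Qed.

End Execution.

End Trees.

Theorem theorem3 :
  forall K1 K2 : nat, exists C : nat,
  forall (n k : nat) (s : side) (T : tree n k)
         (Child : n.-tuple 'I_k -> 'I_n -> option 'I_k)
         (work : n.-tuple 'I_k -> 'I_n -> nat),
    concatenation_tree s T ->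
    implements_Child T Child ->
    (forall v, List.In v (nodes T) ->
       \sum_(i < n) work (label v) i <= K1 * ((size (children v)).+1 * n)) ->
    num_periodic T < K2 * num_aperiodic T ->
    (exists out time,
       RCL Child work (ell s) (label T) (change_index T) out time) /\
    (forall out time,
       RCL Child work (ell s) (label T) (change_index T) out time ->
       time <= C * size out).
Proof.
(* The factor [K2.+1] bounds the ratio of all nodes to aperiodic ones; the other factor is the
   average time per node divided by [n]. *)
move=> K1 K2; exists ((8 + 2 * K1) * K2.+1) => n k s T Child work cT CT W P.
split=> [|out time R]; first exact: RCL_terminates cT CT.
have [-> ->] := RCL_cost cT CT R.
(* The root's change index is a position, so strings are nonempty. *)
have n0 : 0 < n by apply: leq_ltn_trans (ltn_ord (change_index T)).
apply: leq_trans (tree_time_le n0 W) _.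
apply: leq_trans (leq_mul (leqnn _) (num_aperiodic_le T)).
rewrite -!mulnA leq_mul2l; apply/orP; right.
rewrite mulnCA leq_mul2l size_nodes; apply/orP; right; lia.
Qed.
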